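(* Let $G$ be a graph on $[n]$. Then $\mathrm{in}_<(J_G)=I_{\Delta_<}$, where $\Delta_<$ is the simplicial complex on the vertex set $\{x_1,\dots,x_n,y_1,\dots,y_n\}$ whose set of facets is \[ \mathcal{F}(\Delta_<)=\bigcup_{T\in\mathcal{C}(G)}\{F(T,\mathbf{v}) : \mathbf{v}\in V(G_1)\times\cdots\times V(G_{c(T)})\}, \] where, for each $T\in\mathcal{C}(G)$, $G_1,\dots,G_{c(T)}$ denote the connected components of $G\setminus T$ and, for $\mathbf{v}=(v_1,\dots,v_{c(T)})$, \[ F(T,\mathbf{v})=\bigcup_{i=1}^{c(T)}\Big(\{y_j : j\in V(G_i),\ j\le v_i\}\cup\{x_j : j\in V(G_i),\ j\ge v_i\}\Big). \]
   Context: All graphs are finite and simple. Let $G$ be a graph with vertex set $[n]=\{1,\dots,n\}$. For $T\subseteq V(G)$, $G\setminus T$ is the induced subgraph on $V(G)\setminus T$ and $c(T)=c_G(T)$ is the number of its connected components. $T$ is a cutset of $G$ if $c_G(T\setminus\{v\})<c_G(T)$ for every $v\in T$; $\mathcal{C}(G)$ is the set of all cutsets (so $\emptyset\in\mathcal{C}(G)$). Let $\mathbb{K}$ be a field and $S=\mathbb{K}[x_1,\dots,x_n,y_1,\dots,y_n]$. The binomial edge ideal is $J_G=(x_iy_j-x_jy_i : i<j,\ \{i,j\}\in E(G))\subseteq S$. Here $<$ is the lexicographic order on $S$ induced by $x_1>x_2>\cdots>x_n>y_1>\cdots>y_n$, and $\mathrm{in}_<(J_G)$ is the initial ideal. For a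 simplicial complex $\Delta$ whose vertices are the variables of $S$, $I_\Delta$ is the Stanley–Reisner ideal, generated by the squarefree monomials corresponding to the nonfaces of $\Delta$; $\mathcal{F}(\Delta)$ is the set of facets (maximal faces). *)

(* Defs.v *)
From mathcomp Require Import all_boot all_order all_algebra.
From mathcomp.multinomials Require Import mpoly.

Set Implicit Arguments.
Unset Strict Implicit.
Unset Printing Implicit Defensive.

Import Order.TTheory GRing.Theory.

Local Open Scope ring_scope.

(* A graph on [n] is a symmetric irreflexive relation on 'I_n, so that the
   vertex k of [n] = {1, ..., n} is the ordinal of value k - 1. *)
Section Graph.

Variables (n : nat) (e : rel 'I_n).

(* Adjacency in the induced subgraph on the complement of T. *)
Definition del_edge (T : {set 'I_n}) : rel 'I_n :=
  [rel u v | [&& u \notin T, v \notin T & e u v]].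

Definition components (T : {set 'I_n}) : {set {set 'I_n}} :=
  equivalence_partition (connect (del_edge T)) (~: T).

Definition ncomponents (T : {set 'I_n}) : nat := #|components T|.

Definition component (T : {set 'I_n}) (i : 'I_(ncomponents T)) : {set 'I_n} :=
  enum_val i.

Definition cutset (T : {set 'I_n}) : bool :=
  [forall v in T, (ncomponents (T :\ v) < ncomponents T)%N].

End Graph.

(* The 2n variables are indexed by 'I_(n + n), in the order
   x_1, ..., x_n, y_1, ..., y_n. *)
Definition xvar n (i : 'I_n) : 'I_(n + n) := lshift n i.
Definition yvar n (i : 'I_n) : 'I_(n + n) := rshift n i.

Section Ideals.

Variable R : comNzRingType.

Definition ideal_gen (A : R -> Prop) (f : R) : Prop :=
  exists2 s : seq (R * R),
    forall c, c \in s -> A c.2 & f = \sum_(c <- s) c.1 * c.2.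

End Ideals.

Section Initial.

Variables (K : fieldType) (N : nat).

(* The order on monomials provided by mpoly compares degrees first; here the
   exponent vectors themselves are compared lexicographically, hence
   'X_0 > 'X_1 > ... > 'X_(N - 1). *)
Definition lex_le (m1 m2 : 'X_{1..N}) : bool :=
  (((m1 : N.-tuple nat) : N.-tuplelexi nat) <=
   ((m2 : N.-tuple nat) : N.-tuplelexi nat))%O.

(* No monomial is the leading monomial of 0. *)
Definition is_lead_mon (f : {mpoly K[N]}) (m : 'X_{1..N}) : Prop :=
  m \in msupp f /\ forall m', m' \in msupp f -> lex_le m' m.

Definition initial_ideal (I : {mpoly K[N]} -> Prop) : {mpoly K[N]} -> Prop :=
  ideal_gen (fun g => exists f m, [/\ I f, is_lead_mon f m & g = 'X_[m]]).

End Initial.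

Section Complex.

Variable V : finType.

Definition simplicial_complex (D : {set {set V}}) : Prop :=
  (forall v : V, [set v] \in D) /\
  (forall A B : {set V}, A \subset B -> B \in D -> A \in D).

Definition facets (D : {set {set V}}) : {set {set V}} :=
  [set F | maxset (fun A => A \in D) F].

End Complex.

Definition stanley_reisner (K : fieldType) (N : nat) (D : {set {set 'I_N}}) :
    {mpoly K[N]} -> Prop :=
  ideal_gen (fun g => exists2 A : {set 'I_N},
    A \notin D & g = \prod_(i in A) 'X_i).

Section BinomialEdge.

Variables (K : fieldType) (n : nat) (e : rel 'I_n).

Definition binomial_edge_ideal : {mpoly K[n + n]} -> Prop :=
  ideal_gen (fun g => exists i j : 'I_n, [/\ (i < j)%N, e i j &
    g = 'X_(xvar i) * 'X_(yvar j) - 'X_(xvar j) * 'X_(yvar i)]).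

Definition F_set (T : {set 'I_n}) (v : {ffun 'I_(ncomponents e T) -> 'I_n}) :
    {set 'I_(n + n)} :=
  \bigcup_(i < ncomponents e T)
    ([set yvar j | j in component i & (j <= v i)%N] :|:
     [set xvar j | j in component i & (v i <= j)%N]).

(* family (@component n e T) is the product of the vertex sets of the
   components of the graph minus T. *)
Definition F_family : {set {set 'I_(n + n)}} :=
  \bigcup_(T : {set 'I_n} | cutset e T)
    [set F_set v | v in family (@component n e T)].

End BinomialEdge.

(* Main.v *)
(** Call [A] admissible for [T] if it uses only vertices outside [T] and contains
    no [x_i], [y_j] with [i < j] in the same component of [G \ T]; this says that
    [A] is contained in some [F(T, v)].  A minimal [T] for which [A] is admissible
    is a cutset, and the [F(T, v)] with [T] a cutset form an antichain, so they
    are the facets of the complex of all admissible sets.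

    If the support of [m] is admissible for [T], then [m] is lexicographically
    smallest among the monomials with the same values of [m(x_k) + m(y_k)] for
    all [k] and the same total [x]-degree on every component of [G \ T].  The
    sum of the coefficients over this fiber vanishes on [J_G], so [m] is not a
    leading monomial of [J_G].  Conversely, if [A] is not admissible for the set
    [T] of vertices it does not use, then a path in [G \ T] from [i] to [j] with
    [x_i], [y_j] in [A] and [i < j] gives an element of [J_G], namely the binomial
    [x_i y_j - x_j y_i] times one variable of [A] for each interior vertex of the
    path, whose leading monomial divides the product of [A]. *)
Require Import Defs.
From mathcomp Require Import all_boot all_order all_algebra.
From mathcomp.multinomials Require Import mpoly.
From mathcomp Require Import zify ring.

Set Implicit Arguments.
Unset Strict Implicit.
Unset Printing Implicit Defensive.

Import Order.TTheory GRing.Theory.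

(** * Components of G minus T and how they change when a vertex is restored *)

Section Components.

Variables (n : nat) (e : rel 'I_n).
Hypothesis e_sym : ssrbool.symmetric e.

Implicit Types (T : {set 'I_n}) (A B : {set 'I_(n + n)}).

Local Notation conn T := (connect (del_edge e T)).

Lemma conn_sym T u v : conn T u v = conn T v u.
Proof.
by apply: sym_connect_sym => x y; rewrite /del_edge /= e_sym andbCA.
Qed.

Lemma conn_notin T u v : u \notin T -> conn T u v -> v \notin T.
Proof.
move=> uT /connectP [p]; elim: p u uT => [|w p IHp] u uT /=; first by move=> _ ->.
by case/andP => /and3P [_ wT _]; apply: IHp.
Qed.

Lemma conn_sub T T' u v : T \subset T' -> conn T' u v -> conn T u v.
Proof.
move=> sTT'; apply: connect_sub => x y /and3P [xT yT exy]; apply: connect1.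
rewrite /del_edge /= exy.
by rewrite (contra (subsetP sTT' _) xT) (contra (subsetP sTT' _) yT).
Qed.

(** Follow the path from [a]: either it meets [u], or it avoids [u] and all its edges survive in the
    graph minus [T]. *)
Lemma connD1 T a b u : conn (T :\ u) a b -> conn T a b \/ conn (T :\ u) a u.
Proof.
case/connectP => p; elim: p a => [|c p IHp] a /=; first by move=> _ ->; left.
case/andP => eac /IHp {}IHp /IHp [cb|cu]; last first.
  by right; apply: connect_trans cu; apply: connect1.
have [->|au] := eqVneq a u; first by right.
have [cu|cu] := eqVneq c u; first by right; apply: connect1; rewrite -{2}cu.
left; apply: connect_trans cb; apply: connect1.
by move: eac; rewrite /del_edge /= !inE au cu.
Qed.

Local Notation cls T x := [set y in ~: T | conn T x y].

Lemma cls_eq T x y : conn T x y -> cls T x = cls T y.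
Proof.
move=> xy; apply/setP => z; rewrite !inE.
by rewrite (same_connect (@conn_sym T) xy).
Qed.

Lemma componentsP T C :
  reflect (exists2 x, x \notin T & C = cls T x) (C \in components e T).
Proof.
apply: (iffP imsetP) => [[x]|[x xT ->]]; first by rewrite inE => xT ->; exists x.
by exists x; rewrite // inE.
Qed.

Lemma mem_components T x : x \notin T -> cls T x \in components e T.
Proof. by move=> xT; apply/componentsP; exists x. Qed.

Lemma component_conn T (i : 'I_(ncomponents e T)) x y :
  x \in component i -> (y \in component i) = conn T x y.
Proof.
have /componentsP [z zT ->] : component i \in components e T by apply: enum_valP.
rewrite !inE => /andP [xT zx]; rewrite (same_connect (@conn_sym T) zx).
by apply: andb_idl; apply: conn_notin.
Qed.

Lemma component_notin T (i : 'I_(ncomponents e T)) x :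
  x \in component i -> x \notin T.
Proof.
have /componentsP [z zT ->] : component i \in components e T by apply: enum_valP.
by rewrite !inE => /andP [].
Qed.

Lemma component_ex T x :
  x \notin T -> exists i : 'I_(ncomponents e T), x \in component i.
Proof.
move=> xT; have C_in := mem_components xT.
exists (enum_rank_in C_in (cls T x)).
by rewrite /component enum_rankK_in // !inE xT connect0.
Qed.

Lemma component_inj T (i j : 'I_(ncomponents e T)) x :
  x \in component i -> x \in component j -> i = j.
Proof.
move=> xi xj; apply: enum_val_inj; apply/setP => y.
by rewrite (component_conn y xi) (component_conn y xj).
Qed.

Lemma component_neq0 T (i : 'I_(ncomponents e T)) :
  exists x, x \in component i.
Proof.
have /componentsP [z zT Cz] : component i \in components e T by apply: enum_valP.
by exists z; rewrite Cz !inE zT connect0.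
Qed.

(** Restoring [u] glues together the components adjacent to it, so the count drops exactly when two
    different ones get glued. *)
Lemma ncomponentsD1_lt T u : u \in T ->
  (ncomponents e (T :\ u) < ncomponents e T) <->
  exists a b, [/\ a \notin T, b \notin T, conn (T :\ u) a b & ~~ conn T a b].
Proof.
move=> uT; have notinD1 x : x \notin T -> x \notin T :\ u.
  by apply: contra; apply: (subsetP (subD1set _ _)).
split=> [lt|[a [b [aT bT ab nab]]]].
  case: (boolP [exists a, exists b,
                 [&& a \notin T, b \notin T, conn (T :\ u) a b & ~~ conn T a b]]).
    by case/existsP => a /existsP [b /and4P ?]; exists a, b.
  move/existsPn => nex; move: lt; rewrite ltnNge => /negP [].
  (* When nothing is glued, cutting the components for [T :\ u] down to the complement of [T]
     reaches every component for [T], so the count cannot drop. *)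
  apply: leq_trans (leq_imset_card (fun C => C :&: ~: T) _).
  apply: subset_leq_card; apply/subsetP => _ /componentsP [x xT ->]; apply/imsetP.
  exists (cls (T :\ u) x); first by apply: mem_components; apply: notinD1.
  apply/setP => y; rewrite !inE [RHS]andbC; case: (boolP (y \in T)) => //= yT.
  rewrite andbF /=; apply/idP/idP => [|xy]; first exact: conn_sub (subD1set _ _).
  by have /existsPn /(_ y) := nex x; rewrite xT yT xy /= negbK.
(* [h] sends a component for [T] to the component for [T :\ u] that contains it. The classes of [a]
   and [b] have the same image, which also contains [u]; so [h] is still onto after the class of [b]
   is left out. *)
pose h (C : {set 'I_n}) := \bigcup_(x in C) cls (T :\ u) x.
have hE x : x \notin T -> h (cls T x) = cls (T :\ u) x.
  move=> xT; apply/eqP; rewrite eqEsubset; apply/andP; split.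
    apply/bigcupsP => y; rewrite !inE => /andP [_ xy].
    by rewrite (cls_eq (conn_sub (subD1set T u) xy)).
  by apply: (bigcup_max x); rewrite // !inE xT connect0.
have au : conn (T :\ u) a u by case: (connD1 ab) => //; rewrite (negPf nab).
have lt : #|components e T :\ cls T b| < #|components e T|.
  by rewrite [ltnRHS](cardsD1 (cls T b)) mem_components.
apply: leq_ltn_trans lt; apply: leq_trans (leq_imset_card h _).
apply: subset_leq_card; apply/subsetP => _ /componentsP [x xTu ->].
have nab' : cls T a != cls T b.
  apply: contra nab => /eqP eq_ab.
  have : b \in cls T b by rewrite !inE bT connect0.
  by rewrite -eq_ab !inE => /andP [].
have memh y : y \notin T -> cls T y != cls T b ->
    cls (T :\ u) y \in [set h C | C in components e T :\ cls T b].
  move=> yT ne; apply/imsetP; exists (cls T y); last by rewrite hE.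
  by rewrite in_setD1 ne mem_components.
have [xu|xu] := eqVneq x u; first by rewrite xu -(cls_eq au) memh.
have xT : x \notin T by move: xTu; rewrite in_setD1 xu.
have [eq_xb|] := eqVneq (cls T x) (cls T b); last exact: memh.
have xb : conn T x b.
  have : b \in cls T b by rewrite !inE bT connect0.
  by rewrite -eq_xb !inE => /andP [].
rewrite (cls_eq (conn_sub (subD1set T u) xb)) -(cls_eq ab).
exact: memh.
Qed.

Lemma var_split (w : 'I_(n + n)) : (exists j, w = xvar j) \/ (exists j, w = yvar j).
Proof. by case: (split_ordP w) => j ->; [left | right]; exists j. Qed.

(** * The sets F(T, v) *)

Section FSet.

Variables (T : {set 'I_n}) (v : {ffun 'I_(ncomponents e T) -> 'I_n}).

Lemma F_set_xvar j :
  reflect (exists2 i, j \in component i & v i <= j) (xvar j \in F_set v).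
Proof.
apply: (iffP bigcupP) => [[i _]|[i ji vij]]; last first.
  by exists i => //; rewrite inE; apply/orP; right; rewrite imset_f // inE ji.
rewrite inE => /orP [] /imsetP [k] /[!inE] /andP [ki vik] /eqP.
  by rewrite /xvar /yvar eq_lrshift.
by rewrite eq_lshift => /eqP ->; exists i.
Qed.

Lemma F_set_yvar j :
  reflect (exists2 i, j \in component i & j <= v i) (yvar j \in F_set v).
Proof.
apply: (iffP bigcupP) => [[i _]|[i ji vij]]; last first.
  by exists i => //; rewrite inE; apply/orP; left; rewrite imset_f // inE ji.
rewrite inE => /orP [] /imsetP [k] /[!inE] /andP [ki vik] /eqP.
  by rewrite eq_rshift => /eqP ->; exists i.
by rewrite /xvar /yvar eq_rlshift.
Qed.

Lemma F_set_notin j :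
  (xvar j \in F_set v) || (yvar j \in F_set v) = (j \notin T).
Proof.
apply/orP/idP => [[/F_set_xvar|/F_set_yvar] [i ji _]|].
- exact: component_notin ji.
- exact: component_notin ji.
move/component_ex => [i ji]; case: (leqP (v i) j) => [|/ltnW] vij.
  by left; apply/F_set_xvar; exists i.
by right; apply/F_set_yvar; exists i.
Qed.

Hypothesis v_fam : v \in family (@component n e T).

(** Inside one component the [y] part stops at [v i] and the [x] part starts there. Thus the entries
    of [v] can be read off from the set, just as [F_set_notin] reads off [T]. *)
Lemma F_set_both j :
  (xvar j \in F_set v) && (yvar j \in F_set v) = (j \in codom v).
Proof.
apply/andP/codomP => [[/F_set_xvar [i ji vij] /F_set_yvar [k jk jvk]]|[i ->]].
  exists i; apply/val_inj/anti_leq.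
  by rewrite (component_inj jk ji) in jvk; rewrite jvk vij.
have vi := familyP v_fam i.
by split; [apply/F_set_xvar | apply/F_set_yvar]; exists i.
Qed.

End FSet.

(** * Admissible sets, and the facets of the complex they form *)

Definition admissible T A :=
  [forall i, (xvar i \in A) || (yvar i \in A) ==> (i \notin T)] &&
  [forall i : 'I_n, forall j : 'I_n,
    [&& i < j, xvar i \in A & yvar j \in A] ==> ~~ conn T i j].

Lemma admissibleP T A :
  reflect ((forall i, (xvar i \in A) || (yvar i \in A) -> i \notin T) /\
           (forall i j : 'I_n, i < j -> xvar i \in A -> yvar j \in A -> ~~ conn T i j))
          (admissible T A).
Proof.
apply: (iffP andP) => [[/forallP T1 /forallP T2]|[T1 T2]]; split.
- by move=> i; apply/implyP.
- by move=> i j ij iA jA; have /forallP /(_ j) := T2 i; rewrite ij iA jA.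
- by apply/forallP => i; apply/implyP/T1.
- apply/forallP => i; apply/forallP => j; apply/implyP => /and3P [].
  exact: T2.
Qed.

Lemma admissible_sub T A B : A \subset B -> admissible T B -> admissible T A.
Proof.
move=> /subsetP sAB /admissibleP [T1 T2]; apply/admissibleP.
split=> [i iA|i j ij iA jA].
  by apply: T1; case/orP: iA => /sAB ->; rewrite ?orbT.
by apply: T2; rewrite ?sAB.
Qed.

Lemma admissible_F_setP T A :
  admissible T A <-> exists2 v, v \in family (@component n e T) & A \subset F_set v.
Proof.
split=> [/admissibleP [T1 T2]|[v v_fam sAF]]; last first.
  apply: admissible_sub sAF _; apply/admissibleP; split=> [i|i j ij].
    by rewrite F_set_notin.
  move=> /F_set_xvar [k ik vki] /F_set_yvar [l jl jvl]; apply/negP => cij.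
  have jk : j \in component k by rewrite (component_conn _ ik).
  rewrite (component_inj jl jk) in jvl.
  by have := leq_trans jvl vki; rewrite leqNgt ij.
(* The choice is the least [k] in the component with [xvar k] in [A]; admissibility keeps every
   [yvar j] of [A] in the component at or below it. If there is no such [k], the largest vertex of
   the component works. *)
have ex_v (i : 'I_(ncomponents e T)) : exists k : 'I_n, [/\ k \in component i,
    (forall j, j \in component i -> xvar j \in A -> k <= j) &
    (forall j, j \in component i -> yvar j \in A -> j <= k)].
  case: (boolP [exists j, (j \in component i) && (xvar j \in A)]).
    case/existsP => j0 j0P.
    case: (@arg_minnP _ j0 [pred j in component i | xvar j \in A] (@nat_of_ord n) j0P).
    move=> k /andP [ki kA] k_min.
    exists k; split=> // [j ji jA|j ji jA]; first by apply: k_min; rewrite /= ji.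
    rewrite leqNgt; apply/negP => kj; have := T2 _ _ kj kA jA.
    by rewrite -(component_conn _ ki) ji.
  move/existsPn => noA; have [j0 j0i] := component_neq0 i.
  case: (@arg_maxnP _ j0 (mem (component i)) (@nat_of_ord n) j0i) => k ki k_max.
  exists k; split=> // j ji.
  - by move=> jA; have := noA j; rewrite ji jA.
  - by move=> _; apply: k_max.
have [v vP] := fin_all_exists ex_v; exists (finfun v).
  by apply/familyP => i; rewrite ffunE; case: (vP i).
apply/subsetP => w; case: (var_split w) => [] [j ->] jA.
  have [i ji] : exists i : 'I_(ncomponents e T), j \in component i.
    by apply: component_ex; apply: T1; rewrite jA.
  by apply/F_set_xvar; exists i; rewrite // ffunE; case: (vP i) => _ /(_ j ji jA).
have [i ji] : exists i : 'I_(ncomponents e T), j \in component i.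
  by apply: component_ex; apply: T1; rewrite jA orbT.
by apply/F_set_yvar; exists i; rewrite // ffunE; case: (vP i) => _ _ /(_ j ji jA).
Qed.

(** Take [T] minimal. If restoring some [u] of [T] did not lower the number of components, no two
    vertices outside [T] would become newly connected. As [A] uses only such vertices, it would be
    admissible for [T :\ u], against minimality. *)
Lemma admissible_cutset T A :
  admissible T A -> exists2 T', cutset e T' & admissible T' A.
Proof.
case/(@minset_exists _ (admissible^~ A)) => {}T /minsetP [adm T_min] _.
exists T => //; apply/forallP => u; apply/implyP => uT; apply: contraT => not_lt.
suff /T_min : admissible (T :\ u) A.
  by move=> /(_ (subD1set T u)) /setP /(_ u); rewrite !inE eqxx uT.
have /admissibleP [T1 T2] := adm; apply/admissibleP; split=> [i /T1|i j ij iA jA].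
  by apply: contra; apply: (subsetP (subD1set T u)).
apply/negP => cij; case/negP: not_lt; apply/(ncomponentsD1_lt uT).
by exists i, j; split; rewrite ?T1 ?T2 ?iA ?jA ?orbT.
Qed.

(** The inclusion gives [T' \subset T] and makes every entry of [v] an entry of [v']. Each component
    for [T'] holds only one entry of [v'], so distinct components for [T] lie in distinct components
    for [T']. Restoring a vertex of [T] outside [T'] would then glue nothing, which the cutset
    condition forbids; hence the two sets agree. *)
Lemma cutset_F_set_inj T T' (v : {ffun 'I_(ncomponents e T) -> 'I_n})
    (v' : {ffun 'I_(ncomponents e T') -> 'I_n}) :
  cutset e T -> v \in family (@component n e T) ->
  v' \in family (@component n e T') ->
  F_set v \subset F_set v' -> F_set v = F_set v'.
Proof.
move=> cutT v_fam v'_fam sF.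
have sT'T : T' \subset T.
  apply/subsetP => j; apply: contraLR; rewrite -(F_set_notin v) -(F_set_notin v').
  by case/orP => /(subsetP sF) ->; rewrite ?orbT.
have ex_k i : exists k, v i = v' k.
  have : v i \in codom v by apply: codom_f.
  rewrite -F_set_both // => /andP [/(subsetP sF) x_in /(subsetP sF) y_in].
  have : v i \in codom v' by rewrite -F_set_both // x_in.
  by case/codomP => k; exists k.
have conn_eq a b : a \notin T -> b \notin T -> conn T' a b -> conn T a b.
  move=> /component_ex [i ai] /component_ex [j bj] cab.
  have [[k vik] [l vjl]] := (ex_k i, ex_k j).
  have vi := familyP v_fam i; have vj := familyP v_fam j.
  have v'k := familyP v'_fam k; have v'l := familyP v'_fam l.
  have : v' l \in component k.
    rewrite (component_conn _ v'k) -vik -vjl.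
    have c1 : conn T' (v i) a.
      by apply: (conn_sub sT'T); rewrite -(component_conn _ vi).
    have c2 : conn T' b (v j).
      by apply: (conn_sub sT'T); rewrite -(component_conn _ bj).
    exact: connect_trans c1 (connect_trans cab c2).
  move/(component_inj v'l) => eq_kl; subst l.
  have eq_ij : i = j by apply: component_inj vi _; rewrite vik -vjl.
  by subst j; rewrite -(component_conn _ ai).
have eqT : T' = T.
  apply/eqP; rewrite eqEsubset sT'T; apply/subsetP => u uT; apply: contraT => uT'.
  have /forallP /(_ u) /implyP /(_ uT) /(ncomponentsD1_lt uT) := cutT.
  move=> [a [b [aT bT ab /negP []]]]; apply: conn_eq => //; apply: conn_sub ab.
  by rewrite subsetD1 sT'T.
(* Over the same [T], the common vertex [v i = v' k] lies in both component [i] and component [k],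
   so [k = i]. *)
subst T'; congr (F_set _); apply/ffunP => i; have [k vik] := ex_k i.
rewrite vik; congr (v' _); have vi := familyP v_fam i.
by apply: component_inj vi; rewrite vik; apply: (familyP v'_fam k).
Qed.

Definition admissible_sets : {set {set 'I_(n + n)}} :=
  [set A | [exists T, admissible T A]].

Lemma admissible_setsP A : reflect (exists T, admissible T A) (A \in admissible_sets).
Proof. by rewrite inE; apply: existsP. Qed.

Lemma simplicial_admissible_sets : simplicial_complex admissible_sets.
Proof.
split=> [w|A B sAB /admissible_setsP [T adm]]; apply/admissible_setsP; last first.
  by exists T; apply: admissible_sub adm.
exists set0; apply/admissibleP; split=> [i _|i j _]; first by rewrite in_set0.
by rewrite !inE => /eqP <-; rewrite /xvar /yvar eq_rlshift.
Qed.

Lemma facets_admissible_sets : facets admissible_sets = F_family e.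
Proof.
have FP A : reflect (exists T, exists2 v : {ffun 'I_(ncomponents e T) -> 'I_n},
    cutset e T && (v \in family (@component n e T)) & A = F_set v) (A \in F_family e).
  apply: (iffP bigcupP) => [[T cutT /imsetP [v v_fam ->]]|].
    by exists T, v; rewrite ?cutT.
  by case=> T [v /andP [cutT v_fam] ->]; exists T => //; apply: imset_f.
have sub_F A : A \in admissible_sets -> exists2 B, B \in F_family e & A \subset B.
  case/admissible_setsP => T /admissible_cutset [T' cutT'].
  case/admissible_F_setP => v v_fam sAF; exists (F_set v) => //; apply/FP.
  by exists T', v; rewrite ?cutT'.
have F_adm A : A \in F_family e -> A \in admissible_sets.
  case/FP => T [v /andP [_ v_fam] ->]; apply/admissible_setsP; exists T.
  by apply/admissible_F_setP; exists v.
apply/setP => A; rewrite inE; apply/maxsetP/idP => [[/sub_F [B BF sAB] A_max]|AF].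
  by rewrite -(A_max B) // F_adm.
split=> [|B /sub_F [C CF sBC] sAB]; first exact: F_adm.
(* [A] and [C] both belong to the antichain of the F(T, v), and [B] lies between them. *)
have eqAC : A = C.
  case/FP: AF (subset_trans sAB sBC) => T [v /andP [cutT v_fam] ->].
  case/FP: CF => T' [v' /andP [_ v'_fam] ->].
  exact: cutset_F_set_inj.
by apply/eqP; rewrite eqEsubset sAB andbT eqAC.
Qed.

End Components.

Local Open Scope ring_scope.

(** * Generated ideals *)

Section IdealGen.

Variable R : comNzRingType.

Implicit Types (P Q : R -> Prop).

Lemma ideal_gen_mem P g : P g -> ideal_gen P g.
Proof.
move=> Pg; exists [:: (1, g)] => [c|]; first by rewrite inE => /eqP ->.
by rewrite big_seq1 mul1r.
Qed.

Lemma ideal_genD P f g : ideal_gen P f -> ideal_gen P g -> ideal_gen P (f + g).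
Proof.
move=> [s Ps ->] [t Pt ->]; exists (s ++ t); last by rewrite big_cat.
by move=> c; rewrite mem_cat => /orP [/Ps|/Pt].
Qed.

Lemma ideal_genM P h f : ideal_gen P f -> ideal_gen P (h * f).
Proof.
move=> [s Ps ->]; exists [seq (h * c.1, c.2) | c <- s].
  by move=> _ /mapP [c /Ps Pc ->].
by rewrite big_map mulr_sumr; apply: eq_bigr => c _; rewrite mulrA.
Qed.

Lemma ideal_gen_sub P Q f :
  (forall g, P g -> ideal_gen Q g) -> ideal_gen P f -> ideal_gen Q f.
Proof.
move=> PQ [s Ps ->]; rewrite big_seq; elim/big_rec: _ => [|c g cs Qg].
  by exists [::]; rewrite ?big_nil.
by apply: ideal_genD Qg; apply/ideal_genM/PQ/Ps.
Qed.

End IdealGen.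

(** * Lexicographic comparison and leading monomials *)

Section Lex.

Variable N : nat.

Implicit Types m : 'X_{1..N}.

Lemma lex_le_first m1 m2 : lex_le m1 m2 -> m1 <> m2 ->
  exists2 k : 'I_N, forall i : 'I_N, (i < k)%N -> m1 i = m2 i & (m1 k < m2 k)%N.
Proof.
rewrite /lex_le le_eqVlt => /orP [/eqP /val_inj //|/ltxi_tuplePlt [k eq_lt lt] _].
by exists k.
Qed.

Lemma lex_le_of_first m1 m2 (k : 'I_N) :
  (forall i : 'I_N, (i < k)%N -> m1 i = m2 i) -> (m1 k < m2 k)%N -> lex_le m1 m2.
Proof.
by move=> eq_lt lt; rewrite /lex_le; apply/ltW/ltxi_tuplePlt; exists k.
Qed.

Lemma lead_mon_binomial (K : fieldType) m1 m2 : m1 != m2 -> lex_le m2 m1 ->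
  is_lead_mon ('X_[m1] - 'X_[m2] : {mpoly K[N]}) m1.
Proof.
move=> ne le21; split=> [|m].
  rewrite mcoeff_msupp mcoeffB !mcoeffX eqxx (eq_sym m2) (negPf ne) subr0.
  exact: oner_neq0.
move/msuppB_le; rewrite mem_cat !msuppX !inE => /orP [] /eqP -> //.
exact: lexx.
Qed.

End Lex.

Section InitialIdeal.

Variables (K : fieldType) (n : nat) (e : rel 'I_n).
Hypotheses (e_sym : ssrbool.symmetric e) (e_irr : irreflexive e).

Local Notation conn T := (connect (del_edge e T)).
Local Notation J := (@binomial_edge_ideal K n e).

Definition minor (i j : 'I_n) : {mpoly K[n + n]} :=
  'X_(xvar i) * 'X_(yvar j) - 'X_(xvar j) * 'X_(yvar i).

(** * Fibers of monomials and the functional that vanishes on J_G *)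

Section Fiber.

Variables (T : {set 'I_n}) (m : 'X_{1..n + n}).

(** A component is represented by any vertex [k] in it. For [k] in [T] the sum has the single term
    [l = k]; when [m] has admissible support, the first condition already makes both sides zero
    there. *)
Definition in_fiber (q : 'X_{1..n + n}) : bool :=
  [forall k, q (xvar k) + q (yvar k) == m (xvar k) + m (yvar k)]%N &&
  [forall k, \sum_(l | conn T k l) q (xvar l) == \sum_(l | conn T k l) m (xvar l)]%N.

Hypothesis adm : admissible e T [set w | m w != 0%N].

(** Look at the first variable where [q] falls below [m]. It is not [yvar i], since the exponents of
    [xvar i] agree and so does their sum with those of [yvar i]. If it is [xvar i], the [x]-degree
    of the component is made up at some [xvar j] with [j > i]; then [m] contains both [xvar i] and
    [yvar j], a forbidden pair. *)
Lemma fiber_min q : in_fiber q -> lex_le q m -> q = m.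
Proof.
case/andP => /forallP q_deg /forallP q_comp le_qm.
apply/eqP; apply: contraT => /eqP /(lex_le_first le_qm) [w eq_lt lt].
have /admissibleP [_ T2] := adm.
have [[i wE]|[i wE]] := var_split w; subst w; last first.
  have eqx : q (xvar i) = m (xvar i).
    by apply: eq_lt; rewrite /= ltn_addr.
  by have := q_deg i; rewrite eqx eqn_add2l ltn_eqF.
have [j cij ltj] : exists2 j, conn T i j & (m (xvar j) < q (xvar j))%N.
  apply/exists_inP; apply: contraT => /exists_inPn no_j.
  have := q_comp i; rewrite (bigD1 i) //= [X in _ == X](bigD1 i) //=.
  rewrite ltn_eqF // -addSn leq_add // leq_sum // => j /andP [cij _].
  by have := no_j j cij; rewrite -leqNgt.
have ij : (i < j)%N.
  rewrite ltnNge; apply/negP; rewrite leq_eqVlt => /orP [/eqP /val_inj ji|ji].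
    by move: ltj; rewrite ji ltnNge (ltnW lt).
  by move: ltj; rewrite eq_lt ?ltnn.
have := T2 i j ij; rewrite !inE cij /=.
have xi : m (xvar i) != 0%N by rewrite -lt0n (leq_ltn_trans _ lt).
have yj : m (yvar j) != 0%N.
  apply/eqP => yj; have := q_deg j; rewrite yj addn0 gtn_eqF //.
  exact: ltn_addr.
by move=> /(_ xi yj).
Qed.

Lemma fiber_mdeg q : in_fiber q -> mdeg q = mdeg m.
Proof.
case/andP => /forallP q_deg _.
by rewrite !mdegE !big_split_ord /= -!big_split; apply: eq_bigr => k _; apply/eqP/q_deg.
Qed.

Lemma sum_eq_nat (P : pred 'I_n) (i : 'I_n) : (\sum_(k | P k) (i == k) = P i :> nat)%N.
Proof.
rewrite big_mkcond (bigD1 i) //= eqxx big1 ?addn0; first by case: (P i).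
by move=> k ne; rewrite eq_sym (negPf ne) if_same.
Qed.

(** If [i] or [j] is in [T], both monomials use a vertex where [m] has degree zero, so neither is in
    the fiber. Otherwise [i] and [j] share a component, and the swap preserves every degree that the
    fiber fixes. *)
Lemma in_fiber_swap p i j : e i j ->
  in_fiber (p + (U_(xvar i) + U_(yvar j)))%MM =
  in_fiber (p + (U_(xvar j) + U_(yvar i)))%MM.
Proof.
move=> eij; have /admissibleP [T1 _] := adm.
have T0 k : k \in T -> (m (xvar k) + m (yvar k) = 0)%N.
  move=> kT; apply/eqP; rewrite addn_eq0; apply: contraLR kT => mk.
  by apply: T1; rewrite !inE -negb_and.
have notT k (q : 'X_{1..n + n}) :
    k \in T -> (0 < q (xvar k) + q (yvar k))%N -> in_fiber q = false.
  move=> kT q_gt0; apply/negP => /andP [/forallP /(_ k)].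
  by rewrite T0 // gtn_eqF.
have varE := (eq_lshift, eq_rshift, eq_lrshift, eq_rlshift).
have [iT|iT] := boolP (i \in T).
  by rewrite !(notT i) // !mnmDE !mnm1E /xvar /yvar !varE eqxx ?addn0 ?addnS ?addn1.
have [jT|jT] := boolP (j \in T).
  by rewrite !(notT j) // !mnmDE !mnm1E /xvar /yvar !varE eqxx ?addn0 ?addnS ?addn1.
have cij : conn T i j by apply: connect1; rewrite /del_edge /= iT jT.
rewrite /in_fiber; congr andb; apply: eq_forallb => k; congr (_ == _).
  by rewrite !mnmDE !mnm1E /xvar /yvar !varE; lia.
under eq_bigr do rewrite mnmDE mnmDE !mnm1E /xvar /yvar !varE addn0.
under [RHS]eq_bigr do rewrite mnmDE mnmDE !mnm1E /xvar /yvar !varE addn0.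
rewrite !big_split /= !sum_eq_nat; congr (_ + nat_of_bool _)%N.
by rewrite -(same_connect_r (@conn_sym _ _ e_sym T) cij).
Qed.

(** The degree bound makes the index type finite; for admissible [m] it loses nothing, because the
    whole fiber has degree [mdeg m] by [fiber_mdeg]. *)
Definition fiber_sum (f : {mpoly K[n + n]}) : K :=
  \sum_(q : 'X_{1..(n + n) < (mdeg m).+1} | in_fiber q) f@_q.

Lemma fiber_sum_sum I (r : seq I) (P : pred I) F :
  fiber_sum (\sum_(i <- r | P i) F i) = \sum_(i <- r | P i) fiber_sum (F i).
Proof.
by rewrite /fiber_sum exchange_big; apply: eq_bigr => q _; rewrite raddf_sum.
Qed.

Lemma fiber_sumX q : fiber_sum 'X_[q] = (in_fiber q)%:R.
Proof.
rewrite /fiber_sum; under eq_bigr do rewrite mcoeffX.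
have [qf|qf] := boolP (in_fiber q).
  have lt : (mdeg q < (mdeg m).+1)%N by rewrite fiber_mdeg.
  rewrite (bigD1 (BMultinom lt)) //= eqxx big1 ?addr0 // => q' /andP [_ ne].
  by case: eqP => // eq_q; case/eqP: ne; apply: val_inj; rewrite /= -eq_q.
by rewrite big1 // => q' q'f; case: eqP => // eq_q; rewrite eq_q q'f in qf.
Qed.

Lemma fiber_sumM_minor h i j : e i j -> fiber_sum (h * minor i j) = 0.
Proof.
(* By linearity [h] may be taken to be a monomial; the two terms of the product are then both in the
   fiber or both outside it. *)
move=> eij; rewrite [h]mpolyE mulr_suml fiber_sum_sum big1 // => p _.
rewrite -scalerAl /fiber_sum; under eq_bigr do rewrite mcoeffZ.
rewrite -mulr_sumr /minor mulrBr -!mpolyXD.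
under eq_bigr do rewrite mcoeffB.
by rewrite sumrB -!/(fiber_sum _) !fiber_sumX in_fiber_swap // subrr mulr0.
Qed.

Lemma fiber_sum_binomial_edge f : J f -> fiber_sum f = 0.
Proof.
case=> s sP ->; rewrite fiber_sum_sum big_seq big1 // => c /sP [i [j [_ eij ->]]].
exact: fiber_sumM_minor.
Qed.

End Fiber.

(** Were the support of [m] admissible, [fiber_min] would leave [m] as the only monomial of [f] in
    its fiber. The fiber sum of [f] would be its leading coefficient, yet it is zero. *)
Lemma lead_mon_notin_admissible_sets f m : J f -> is_lead_mon f m ->
  [set w | m w != 0%N] \notin admissible_sets e.
Proof.
move=> Jf [mf m_max]; apply/negP => /admissible_setsP [T adm].
have mm : in_fiber T m m by apply/andP; split; apply/forallP => k.
have := fiber_sum_binomial_edge adm Jf; rewrite /fiber_sum.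
have lt : (mdeg m < (mdeg m).+1)%N by [].
rewrite (bigD1 (BMultinom lt)) //= big1 ?addr0.
  by apply/eqP; rewrite -mcoeff_msupp.
move=> q /andP [qf ne]; apply: memN_msupp_eq0; apply: contra ne => qs.
by apply/eqP/val_inj/(fiber_min adm qf)/m_max.
Qed.

(** * Elements of J_G obtained from paths, and the nonfaces they account for *)

(* By induction on the path, from
   [x_k f_ij = x_i f_kj + x_j f_ik] and [y_k f_ij = y_i f_kj + y_j f_ik]. *)
Lemma minor_path (z : 'I_n -> 'I_(n + n)) q i j :
  (forall k, z k = xvar k \/ z k = yvar k) -> path e i (rcons q j) ->
  J ((\prod_(k <- q) 'X_(z k)) * minor i j).
Proof.
move=> zE; have J_edge a b : e a b -> J (minor a b).
  move=> eab; case: (ltngtP a b) => [ab|ba|/val_inj ab].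
  - by apply: ideal_gen_mem; exists a, b.
  - have -> : minor a b = -1 * minor b a by rewrite /minor; ring.
    by apply/ideal_genM/ideal_gen_mem; exists b, a; rewrite e_sym.
  by rewrite ab e_irr in eab.
elim: q i => [|k q IHq] i /=; first by rewrite andbT big_nil mul1r; apply: J_edge.
case/andP => eik /IHq {}IHq; rewrite big_cons.
have [a [b ->]] : exists a b, 'X_(z k) * (\prod_(l <- q) 'X_(z l)) * minor i j =
    a * (\prod_(l <- q) 'X_(z l) * minor k j) + b * minor i k.
  rewrite /minor; case: (zE k) => ->.
    exists 'X_(xvar i), ((\prod_(l <- q) 'X_(z l)) * 'X_(xvar j)); ring.
  exists 'X_(yvar i), ((\prod_(l <- q) 'X_(z l)) * 'X_(yvar j)); ring.
by apply: ideal_genD; apply: ideal_genM => //; apply: J_edge.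
Qed.

Lemma prod_mpolyX (I : Type) (s : seq I) (P : pred I) (F : I -> 'I_(n + n)) :
  \prod_(i <- s | P i) 'X_(F i) =
  'X_[(\sum_(i <- s | P i) U_(F i))%MM] :> {mpoly K[n + n]}.
Proof.
apply/esym/(big_morph (fun m => 'X_[m] : {mpoly K[n + n]})) => [m1 m2|].
  exact: mpolyXD.
exact: mpolyX0.
Qed.

Lemma lex_minor (r : 'X_{1..n + n}) (i j : 'I_n) : (i < j)%N ->
  let m1 := (r + (U_(xvar i) + U_(yvar j)))%MM in
  let m2 := (r + (U_(xvar j) + U_(yvar i)))%MM in
  m1 != m2 /\ lex_le m2 m1.
Proof.
move=> ij m1 m2; have neq (w w' : 'I_(n + n)) : (w < w')%N -> (w' == w) = false.
  by move=> ww'; rewrite eq_sym -val_eqE ltn_eqF.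
have lt : (m2 (xvar i) < m1 (xvar i))%N.
  by rewrite !mnmDE !mnm1E eqxx !neq //= ?ltn_add2l // ltn_addr.
split; first by apply: contraTneq lt => ->; rewrite ltnn.
(* A variable before [xvar i] is none of the four that occur in the minor. *)
apply: lex_le_of_first lt => w /= wi; rewrite !mnmDE !mnm1E !neq //=; lia.
Qed.

Lemma nonface_prod_initial A : A \notin admissible_sets e ->
  initial_ideal J (\prod_(w in A) 'X_w : {mpoly K[n + n]}).
Proof.
pose T := [set k | (xvar k \notin A) && (yvar k \notin A)].
move/admissible_setsP => not_adm.
have [i [j [ij iA jA cij]]] : exists i j : 'I_n,
    [/\ (i < j)%N, xvar i \in A, yvar j \in A & conn T i j].
  case: (boolP [exists i : 'I_n, exists j : 'I_n,
      [&& (i < j)%N, xvar i \in A, yvar j \in A & conn T i j]]).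
    by case/existsP => i /existsP [j /and4P ?]; exists i, j.
  move/existsPn => no_ij; case: not_adm; exists T; apply/admissibleP.
  split=> [k|i j ij iA jA]; first by rewrite inE -negb_or negbK.
  by have /existsPn /(_ j) := no_ij i; rewrite ij iA jA.
(* For a vertex outside [T], [z k] is a variable of [A]; this is the factor contributed by an
   interior vertex of the path. *)
pose z k := if xvar k \in A then xvar k else yvar k.
have zE k : z k = xvar k \/ z k = yvar k by rewrite /z; case: ifP; [left | right].
have varE := (eq_lshift, eq_rshift, eq_lrshift, eq_rlshift).
have z_inj : injective z.
  move=> k l /eqP; case: (zE k) => ->; case: (zE l) => ->;
  by rewrite /xvar /yvar !varE // => /eqP.
(* A path without repeated vertices is needed for the leading monomial to be squarefree. *)
case/connectP: cij => p0 p0_path; case/shortenP: p0_path => p p_path p_uniq _.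
case/lastP: p p_path p_uniq => [|q j'] p_path p_uniq; rewrite ?last_rcons => jE.
  by move: ij; rewrite jE ltnn.
(* [W] lists the variables of the leading monomial. It has no repetition and lies in [A], so its
   product divides that of [A]. *)
subst j'; pose W := [:: xvar i, yvar j & map z q].
have W_uniq : uniq W.
  move: p_uniq; rewrite /= mem_rcons inE rcons_uniq negb_or map_inj_uniq //.
  case/and3P => /andP [_ iq] jq ->; rewrite inE /xvar /yvar !varE /= andbT.
  apply/andP; split; apply/mapP => -[k kq] /eqP.
    case: (zE k) => ->; rewrite /xvar /yvar !varE // => /eqP ik.
    by rewrite ik kq in iq.
  case: (zE k) => ->; rewrite /xvar /yvar !varE // => /eqP jk.
  by rewrite jk kq in jq.
have W_sub : {subset W <= A}.
  have qT k : k \in q -> k \notin T.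
    have: path (del_edge e T) i q by move: p_path; rewrite rcons_path => /andP [].
    move=> /path_connect q_conn kq; apply: (conn_notin _ (q_conn k _)).
      by rewrite inE iA.
    by rewrite inE kq orbT.
  move=> w; rewrite !inE => /or3P [/eqP ->|/eqP ->|/mapP [k /qT kT ->]] //.
  by move: kT; rewrite inE -negb_or negbK /z; case: ifP.
have -> : \prod_(w in A) 'X_w =
    (\prod_(w in A | w \notin W) 'X_w) * \prod_(w <- W) 'X_w :> {mpoly K[n + n]}.
  rewrite (bigID (mem W)) mulrC /=; congr (_ * _).
  by rewrite [RHS]big_uniq //=; apply: eq_bigl => w; apply/andb_idl/W_sub.
apply/ideal_genM/ideal_gen_mem; pose r := (\sum_(k <- q) U_(z k))%MM.
have Xr : \prod_(k <- q) 'X_(z k) = 'X_[r] :> {mpoly K[n + n]}.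
  exact: prod_mpolyX.
have [ne le] := lex_minor r ij.
exists ('X_[r] * minor i j), (r + (U_(xvar i) + U_(yvar j)))%MM; split.
- rewrite -Xr; apply: minor_path => //; apply: sub_path p_path => a b.
  by case/and3P.
- by rewrite /minor mulrBr -!mpolyXD; apply: lead_mon_binomial.
by rewrite !big_cons big_map Xr mulrA mulrC !mpolyXD.
Qed.

(** * Equality of the initial ideal and the Stanley-Reisner ideal *)

Lemma initial_ideal_binomial_edge f :
  initial_ideal J f <-> stanley_reisner (admissible_sets e) f.
Proof.
split; apply: ideal_gen_sub => g; last first.
  by case=> A nA ->; apply: nonface_prod_initial.
case=> h [m [Jh m_lead ->]]; pose A := [set w | m w != 0%N].
(* Every variable of the support has exponent at least one, so the squarefree monomial of the
   support divides ['X_[m]]. *)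
have -> : 'X_[m] = 'X_[m - \sum_(w in A) U_(w)] * \prod_(w in A) 'X_w
    :> {mpoly K[n + n]}.
  rewrite prod_mpolyX -mpolyXD submK //; apply/mnm_lepP => w.
  rewrite mnm_sumE; have [wA|wA] := boolP (w \in A).
    rewrite (bigD1 w) //= mnm1E eqxx big1 ?addn0; first by move: wA; rewrite inE lt0n.
    by move=> k /andP [_ ne]; rewrite mnm1E (negPf ne).
  rewrite big1 // => k kA; rewrite mnm1E; case: eqP => // kw.
  by rewrite -kw kA in wA.
apply/ideal_genM/ideal_gen_mem; exists A => //.
exact: lead_mon_notin_admissible_sets m_lead.
Qed.

End InitialIdeal.

Theorem corollary2p2 (K : fieldType) (n : nat) (e : rel 'I_n)
    (e_sym : ssrbool.symmetric e) (e_irr : irreflexive e) :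
  exists D : {set {set 'I_(n + n)}},
    [/\ simplicial_complex D,
        facets D = F_family e &
        forall f : {mpoly K[n + n]},
          initial_ideal (binomial_edge_ideal e) f <-> stanley_reisner D f].
Proof.
exists (admissible_sets e); split.
- exact: simplicial_admissible_sets.
- exact: facets_admissible_sets.
- exact: initial_ideal_binomial_edge.
Qed.
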